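(* Let $t$ be a positive integer and $c_0,c_1,\ldots,c_k$ positive integers with $k\ge2$ and $c_0\mid c_i$ for $1\le i\le k$; for each $i$ write $c_i=\nu_i\omega_i$ with $\omega_i$ the greatest divisor of $c_i$ relatively prime to $t$. Then: (i) $\mathcal T_t(c_0;c_1,\ldots,c_k)\cong\mathcal T_t(c_0;c_{\theta(1)},\ldots,c_{\theta(k)})$ for every permutation $\theta$ of $\{1,\ldots,k\}$; (ii) if $\gcd(c_0,t)=1$, then $\mathcal T_t(c_0;c_1,\ldots,c_k)\cong\sum_{i=1}^kT_{\gcd_t(\nu_i)}$; (iii) if $\gcd(t,c_k/c_0)=1$, then $\mathcal T_t(c_0;c_1,\ldots,c_{k-1},c_k)\cong\mathcal T_t(c_0;c_1,\ldots,c_{k-1})$; (iv) if $c_k\mid t$, then $\mathcal T_t(c_0;c_1,\ldots,c_{k-1},c_k)\cong\mathcal T_t(c_0;c_1,\ldots,c_{k-1})+\langle(c_k-c_0)\times\bullet\rangle$; (v) $\mathcal T_t(c_0;c_1)\cong T_{\gcd_t(c_1)}$ (for any positive integers $c_0\mid c_1$).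
   Context: For positive integers $c_0\mid c_i$ ($1\le i\le k$, $k\ge1$), let $F=F(c_0;c_1,\ldots,c_k)$ be the set obtained from the disjoint union $\bigsqcup_{i=0}^k\{i\}\times\mathbb Z_{c_i}$ by identifying $(i,x'c_i/c_0)$ with $(0,x')$ for every $1\le i\le k$ and $x'\in\mathbb Z_{c_0}$. The map $\varphi_t:F\to F$, $[(i,x)]\mapsto[(i,tx)]$, is well defined, and $\mathcal T_t(c_0;c_1,\ldots,c_k)$ denotes the rooted tree attached to $[(0,0)]$ in the functional graph of $\varphi_t$ on $F$ (the digraph with edges $u\to\varphi_t(u)$; the tree attached to a periodic vertex $v$ consists of all $u$ whose forward orbit first meets the periodic points at $v$, with edges $u\to\varphi_t(u)$ for $u\ne v$). Rooted trees have edges toward the root; $\bullet$ is the one-vertex tree; $m\times H$ is $m$ disjoint copies; for a forest $F'=\bigoplus T_i$, $\langle F'\rangle$ is the tree whose root's children are roots of copies of the $T_i$, $\langle\emptyset\rangle=\bullet$; for trees $T_i=\langle F_i\rangle$, $\sum_i T_i=\langle\bigoplus_iF_i\rangle$ (roots identified). Iterated gcd: $\gcd_t(n)=(1)$ if $\gcd(t,n)=1$; otherwise $(\nu_1,\ldots,\nu_D)$ with $\nu_1=\gcd(t,n)$, $\nu_{i+1}=\gcd(t,n/(\nu_1\cdots\nu_i))$, $D$ least with $\nu_{D+1}=1$. Elementary tree of a non-increasing sequence $\mathbf v=(\nu_1,\ldots,\nu_d)$: $T^0_{\mathbf v}=\bullet$; for $1\le k<d$, $T^k_{\mathbf v}=\langle\nu_k\times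 T^{k-1}_{\mathbf v}\oplus\bigoplus_{i=1}^{k-1}(\nu_i-\nu_{i+1})\times T^{i-1}_{\mathbf v}\rangle$; $T_{\mathbf v}=\langle(\nu_d-1)\times T^{d-1}_{\mathbf v}\oplus\bigoplus_{i=1}^{d-1}(\nu_i-\nu_{i+1})\times T^{i-1}_{\mathbf v}\rangle$. *)

(* Defs.v *)
From HB Require Import structures.
From mathcomp Require Import all_boot zmodp.

Set Implicit Arguments.
Unset Strict Implicit.
Unset Printing Implicit Defensive.

Local Open Scope quotient_scope.

(** * Finite rooted trees *)

(* A finite rooted tree with edges toward the root is given by its parent
   map; the root has no outgoing edge, [tparent] fixes it by convention. *)
Record rtree := RTree {
  tvertex : finType;
  troot : tvertex;
  tparent : tvertex -> tvertex;
  tparent_root : tparent troot = troot;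
  tparent_reach : forall v, exists n, iter n tparent v = troot
}.

Definition tedge (T : rtree) : rel (tvertex T) :=
  fun u v => (u != troot T) && (tparent u == v).

Definition tiso (T1 T2 : rtree) : Prop :=
  exists f : tvertex T1 -> tvertex T2,
    [/\ bijective f, f (troot T1) = troot T2
      & forall u v, tedge (f u) (f v) = tedge u v].

Notation "T1 ~=~ T2" := (tiso T1 T2) (at level 70, no associativity).

Lemma bullet_reach (v : unit) : exists n, iter n id v = tt.
Proof. by exists 0; case: v. Qed.

Definition bullet : rtree := RTree (erefl tt) bullet_reach.

(** ** Forests, and the tree obtained by adding a root below a forest *)

Record forest := Forest { fidx : finType; fcomp :> fidx -> rtree }.

Definition fempty : forest := @Forest void (fun=> bullet).

Definition copies (m : nat) (T : rtree) : forest := @Forest 'I_m (fun=> T).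

Definition fadd (F G : forest) : forest :=
  @Forest (fidx F + fidx G)%type
    (fun x => match x with inl i => F i | inr j => G j end).

(* F 0 (+) F 1 (+) ... (+) F n.-1 *)
Definition fbig (F : nat -> forest) : nat -> forest :=
  fix fbig n := if n is m.+1 then fadd (fbig m) (F m) else fempty.

Definition fsum (I : finType) (F : I -> forest) : forest :=
  @Forest {i : I & fidx (F i)} (fun p => F (tag p) (tagged p)).

Section Node.
Variable F : forest.

Definition node_vertex : finType := option {i : fidx F & tvertex (F i)}.

Definition node_parent (x : node_vertex) : node_vertex :=
  if x is Some p then
    if tagged p == troot (F (tag p)) then None
    else Some (Tagged (fun i => tvertex (F i)) (tparent (tagged p)))
  else None.

Lemma node_reach x : exists n, iter n node_parent x = None.
Proof.
case: x => [[i v]|]; last by exists 0.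
have [n] := tparent_reach v; elim: n v => [|n IHn] v.
  by move=> /= vr; exists 1; rewrite /= vr eqxx.
rewrite iterSr => /IHn[m mE].
exists m.+1; rewrite iterSr /=; case: eqP => _; last by [].
by elim: m {mE} => //= m ->.
Qed.

Definition node : rtree := @RTree node_vertex None node_parent erefl node_reach.
End Node.

(** ** Sum of rooted trees: disjoint union with all the roots identified *)
(* [tsum_node] checks that the sum of the <F_i> is <(+)_i F_i>. *)

Section TreeSum.
Variables (I : finType) (T : I -> rtree).

Definition tsum_nonroot (i : I) : finType := {v : tvertex (T i) | v != troot (T i)}.

Definition tsum_vertex : finType := option {i : I & tsum_nonroot i}.

Definition tsum_parent (x : tsum_vertex) : tsum_vertex :=
  if x is Some p then
    omap (Tagged tsum_nonroot (i := tag p)) (insub (tparent (val (tagged p))))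
  else None.

Lemma tsum_reach x : exists n, iter n tsum_parent x = None.
Proof.
case: x => [[i v]|]; last by exists 0.
have [n] := tparent_reach (val v); elim: n v => [|n IHn] v.
  by move=> /eqP vr; case/negP: (valP v).
rewrite iterSr => pE.
case E: (insub (tparent (val v)) : option (tsum_nonroot i)) => [w|].
  have wE : val w = tparent (val v).
    by move: E; case: insubP => // w' _ <- [<-].
  rewrite -wE in pE; have [m mE] := IHn w pE.
  by exists m.+1; rewrite iterSr /= E.
by exists 1; rewrite /= E.
Qed.

Definition tsum : rtree := @RTree tsum_vertex None tsum_parent erefl tsum_reach.
End TreeSum.

Definition tadd (T1 T2 : rtree) : rtree :=
  tsum (fun b : bool => if b then T2 else T1).

Lemma tsum_node (I : finType) (F : I -> forest) :
  tsum (fun i => node (F i)) ~=~ node (fsum F).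
Proof.
pose T i := node (F i).
pose f (x : tsum_vertex T) : node_vertex (fsum F) :=
  if x is Some (existT i v) then
    if val v is Some (existT j w) then
      Some (existT (fun p => tvertex (fsum F p)) (existT (fun i => fidx (F i)) i j) w)
    else None
  else None.
pose g (x : node_vertex (fsum F)) : tsum_vertex T :=
  if x is Some (existT (existT i j) w) then
    Some (existT (tsum_nonroot T) i
      (exist (fun v => v != troot (T i))
        (Some (existT (fun j => tvertex (F i j)) j w)) isT))
  else None.
have fK : cancel f g.
  case=> [[i [[[j w]|] vP]]|] //=.
  by congr (Some (existT _ _ _)); apply: val_inj.
have gK : cancel g f by case=> [[[i j] w]|].
exists f; split=> //; first by exists g.
have fpar x : f (tsum_parent x) = node_parent (f x).
  case: x => [[i [[[j w]|] vP]]|] //=.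
  by case: (w == _); [rewrite insubF | rewrite insubT].
move=> u v; rewrite /tedge /= -fpar (can_eq fK).
by rewrite -[X in f u != X]/(f None) (can_eq fK).
Qed.

(** * Trees attached to the periodic points of a functional graph *)

Section FunctionalGraph.
Variables (V : finType) (f : V -> V).

Definition periodic (u : V) : bool := fconnect f (f u) u.

Lemma periodicP u : reflect (exists2 n, 0 < n & iter n f u = u) (periodic u).
Proof.
apply: (iffP idP) => [/iter_findex uE|[[//|n] _ uE]].
  by exists (findex f (f u) u).+1; rewrite // iterSr.
by rewrite /periodic -{2}uE iterSr fconnect_iter.
Qed.

(* The forward orbit of u meets the periodic points first at v (for v
   periodic); the bound on n is harmless, see [attachedP]. *)
Definition attached (v u : V) : bool :=
  [exists n : 'I_#|V|, (iter n f u == v)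
     && [forall m : 'I_n, ~~ periodic (iter m f u)]].

Lemma attachedP v u :
  reflect (exists2 n, iter n f u = v & forall m, m < n -> ~~ periodic (iter m f u))
          (attached v u).
Proof.
apply: (iffP existsP) => [[n /andP[/eqP uv /forallP np]]|[n uv np]].
  by exists n => // m mn; exact: np (Ordinal mn).
have uvc : fconnect f u v by rewrite -uv fconnect_iter.
have lt_o := findex_max uvc.
have le_n : findex f u v <= n.
  have [lt_n|le_n] := ltnP n (order f u); last exact: ltnW (leq_trans lt_o le_n).
  by rewrite -uv findex_iter.
exists (Ordinal (leq_trans lt_o (max_card _))); rewrite iter_findex // eqxx /=.
by apply/forallP=> m; apply: np; exact: leq_trans (ltn_ord m) le_n.
Qed.

Variable v : V.

Definition att_vertex : finType := {u : V | attached v u}.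

Lemma attached_refl : attached v v.
Proof. by apply/attachedP; exists 0. Qed.

Lemma attached_step u : attached v u -> u != v -> attached v (f u).
Proof.
move=> /attachedP[[|n] uv np] uNv; first by rewrite -uv eqxx in uNv.
apply/attachedP; exists n; first by rewrite -iterSr.
by move=> m mn; rewrite -iterSr; apply: np.
Qed.

Definition att_root : att_vertex := exist _ v attached_refl.

(* The default value of [insubd] is never used, by [attached_step]. *)
Definition att_parent (u : att_vertex) : att_vertex :=
  if u == att_root then att_root else insubd att_root (f (val u)).

Lemma att_parentE u : u != att_root -> val (att_parent u) = f (val u).
Proof.
move=> uNr; rewrite /att_parent (negPf uNr) insubdK //.
exact: attached_step (valP u) uNr.
Qed.

Lemma att_parent_root : att_parent att_root = att_root.
Proof. by rewrite /att_parent eqxx. Qed.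

Lemma att_reach u : exists n, iter n att_parent u = att_root.
Proof.
have /attachedP[n uv _] := valP u; exists n.
elim: n u uv => [|n IHn] u uv; first exact: val_inj.
have [->|uNr] := eqVneq u att_root; first exact: iter_fix att_parent_root.
by rewrite iterSr; apply: IHn; rewrite att_parentE // -iterSr.
Qed.

Definition attached_tree : rtree := RTree att_parent_root att_reach.
End FunctionalGraph.

(** * The set F(c0; c1, ..., ck) and the map phi_t *)

(* Z_c, for c > 0; writing c as c.-1.+1 provides the class of 0. *)
Notation Zmod c := 'I_(c.-1).+1.

Section Fan.
Variables (c0 : nat) (cs : seq nat).

(* c_0, c_1, ..., c_k *)
Definition fan_mod (i : 'I_(size cs).+1) : nat := nth 0 (c0 :: cs) i.

Definition fan_pt : finType := {i : 'I_(size cs).+1 & Zmod (fan_mod i)}.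

Definition fan_mk (i : 'I_(size cs).+1) (x : Zmod (fan_mod i)) : fan_pt :=
  Tagged (fun i => Zmod (fan_mod i)) x.

(* (i, x' c_i / c_0) is identified with (0, x') for i >= 1 *)
Definition fan_ident : rel fan_pt := fun p q =>
  [exists i : 'I_(size cs).+1, exists x : Zmod c0,
    [&& i != ord0, p == fan_mk (inZp (x * (fan_mod i %/ c0)) : Zmod (fan_mod i))
      & q == @fan_mk ord0 x]].

Definition fan_rel : rel fan_pt :=
  connect (fun p q => fan_ident p q || fan_ident q p).

Lemma fan_rel_refl : reflexive fan_rel. Proof. exact: connect0. Qed.
Lemma fan_rel_sym : symmetric fan_rel.
Proof. by apply: sym_connect_sym => p q; rewrite orbC. Qed.
Lemma fan_rel_trans : transitive fan_rel. Proof. exact: connect_trans. Qed.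

Canonical fan_equiv := EquivRel fan_rel fan_rel_refl fan_rel_sym fan_rel_trans.

Definition fan := {eq_quot fan_equiv}.
HB.instance Definition _ :=
  Finite.copy fan (can_type (@EquivQuot.ereprK _ _ _ _ _ (defaultEncModRel fan_equiv))).

Definition fan_class (p : fan_pt) : fan := \pi_fan p.

Definition fan_mul (t : nat) (p : fan_pt) : fan_pt :=
  fan_mk (inZp (t * tagged p) : Zmod (fan_mod (tag p))).

(* Independent of the chosen representative, see [fan_mapE]. *)
Definition fan_map (t : nat) (u : fan) : fan := fan_class (fan_mul t (repr u)).

Lemma fan_mapE (t : nat) :
  0 < c0 -> all (fun c => (0 < c) && (c0 %| c)) cs ->
  forall p, fan_map t (fan_class p) = fan_class (fan_mul t p).
Proof.
move=> c0_gt0 /allP cs_ok p.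
have identP a b : fan_ident a b -> fan_rel (fan_mul t a) (fan_mul t b).
  move=> /existsP[i /existsP[x /and3P[iN0 /eqP-> /eqP->]]].
  have /cs_ok/andP[ci_gt0 c0_ci] : fan_mod i \in cs.
    case: i iN0 => -[|i] // ilt _; exact: mem_nth.
  apply: connect1; apply/orP; left; apply/existsP; exists i; apply/existsP.
  exists (inZp (t * x)); rewrite iN0 /fan_mul /= eqxx andbT; apply/eqP.
  congr fan_mk; apply: val_inj; rewrite /=.
  have -> : (t * x) %% c0.-1.+1 = (t * x) %% c0.
    by move: (t * x) => y; rewrite prednK.
  by rewrite (prednK ci_gt0) muln_modl (mulnC c0) divnK // modn_mod modnMmr mulnA.
have relP a b : fan_rel a b -> fan_rel (fan_mul t a) (fan_mul t b).
  case/connectP=> s; elim: s a => [|a' s IHs] a /=.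
    by move=> _ ->; exact: fan_rel_refl.
  case/andP=> step /IHs{}IHs /IHs; apply: fan_rel_trans.
  by case/orP: step => /identP //; rewrite fan_rel_sym.
rewrite /fan_map /fan_class; apply/eqmodP; apply: relP; apply/eqmodP.
by rewrite reprK.
Qed.

Definition fan_root : fan := fan_class (@fan_mk ord0 ord0).
End Fan.

Definition fan_tree (t c0 : nat) (cs : seq nat) : rtree :=
  attached_tree (@fan_map c0 cs t) (fan_root c0 cs).

(** * Iterated gcd and elementary trees *)

(* (nu_1, ..., nu_d), with nu_(i+1) = gcd(t, n / (nu_1 ... nu_i)) *)
Fixpoint igcd_prefix (t n d : nat) : seq nat :=
  if d is e.+1 then
    let s := igcd_prefix t n e in rcons s (gcdn t (n %/ \prod_(x <- s) x))
  else [::].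

Definition igcd_next (t n d : nat) : nat :=
  gcdn t (n %/ \prod_(x <- igcd_prefix t n d) x).

(* Least D with nu_(D+1) = 1; the search bound is justified by
   [igcd_lengthP]. *)
Definition igcd_length (t n : nat) : nat :=
  find (fun d => igcd_next t n d == 1) (iota 0 n).

Definition igcd (t n : nat) : seq nat :=
  if gcdn t n == 1 then [:: 1] else igcd_prefix t n (igcd_length t n).

Lemma igcd_lengthP (t n : nat) : 0 < n ->
  igcd_next t n (igcd_length t n) = 1
  /\ forall d, igcd_next t n d = 1 -> igcd_length t n <= d.
Proof.
move=> n_gt0; pose P d := igcd_next t n d == 1.
have dvd_pre d : \prod_(x <- igcd_prefix t n d) x %| n.
  elim: d => [|d IHd] /=; first by rewrite big_nil dvd1n.
  by rewrite big_rcons /= -[X in _ %| X](divnK IHd) mulnC dvdn_mul ?dvdn_gcdr.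
have next_gt0 d : 0 < igcd_next t n d.
  rewrite gcdn_gt0 divn_gt0 ?(dvdn_gt0 n_gt0 (dvd_pre d)) //.
  by rewrite (dvdn_leq n_gt0 (dvd_pre d)) orbT.
have hasP : has P (iota 0 n).
  apply: contraT => /hasPn noP.
  suff le_pre d : d <= n -> 2 ^ d <= \prod_(x <- igcd_prefix t n d) x.
    have := leq_trans (le_pre _ (leqnn n)) (dvdn_leq n_gt0 (dvd_pre n)).
    by rewrite leqNgt ltn_expl.
  elim: d => [|d IHd] dn /=; first by rewrite big_nil.
  rewrite big_rcons /= expnSr leq_mul ?IHd ?(ltnW dn) //.
  have := noP d; rewrite mem_iota /= add0n => /(_ dn).
  by rewrite /P -/(igcd_next t n d) neq_ltn ltnNge next_gt0.
split.
  have := nth_find 0 hasP; rewrite nth_iota ?add0n; first by move/eqP.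
  by rewrite -[X in _ < X](size_iota 0 n) -has_find.
move=> d dP; have [//|lt_d] := leqP (igcd_length t n) d.
have := before_find 0 lt_d; rewrite nth_iota ?add0n ?dP //.
apply: leq_trans lt_d _; rewrite -{2}(size_iota 0 n); exact: find_size.
Qed.

(* In both definitions below nu_i is [nth 0 v i.-1]; the truncated
   subtractions are exact since v is meant to be non-increasing. *)
Fixpoint elem_sub (v : seq nat) (k : nat) : rtree :=
  if k is j.+1 then
    node (fadd (copies (nth 0 v j) (elem_sub v j))
               (fbig (fun i => copies (nth 0 v i - nth 0 v i.+1) (elem_sub v i)) j))
  else bullet.

Definition elem_tree (v : seq nat) : rtree :=
  let d := size v in
  node (fadd (copies (nth 0 v d.-1 - 1) (elem_sub v d.-1))
             (fbig (fun i => copies (nth 0 v i - nth 0 v i.+1) (elem_sub v i)) d.-1)).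

(** * The decomposition c = nu * omega relative to t *)

Definition omega_part (t c : nat) : nat :=
  \max_(d <- divisors c | coprime d t) d.

Definition nu_part (t c : nat) : nat := c %/ omega_part t c.

(* Main.v *)
Require Import Defs.
From Corelib Require Import Setoid.
From mathcomp Require Import all_boot perm zmodp.

(* Two rooted trees whose vertices are labelled so that the number of children
   of each label depends only on the label of the parent are isomorphic as soon
   as their roots have the same label.  For x -> t x on Z_n, label x by the
   largest l such that gcd(t^l, n) divides x (infinite for x = 0): solving linear
   congruences shows that x has nu_(l+1) children of label at least l when
   l + 1 <= label(x), and none otherwise, with nu the iterated gcd.  The
   elementary tree carries a labelling with the same counts, whence (v).  The
   other parts compare trees through representatives (i, x) of their vertices:
   two points (i, x) and (j, y) of a fan with i <> j agree exactly when
   x = x' c_i / c_0 and y = x' c_j / c_0 for some x', and (i, x) belongs to the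
   tree when t^N x = 0 in Z_(c_i) for some N. *)

Set Implicit Arguments.
Unset Strict Implicit.
Unset Printing Implicit Defensive.

(** * Isomorphisms of rooted trees as parent-preserving bijections *)

Lemma tiso_sym (T1 T2 : rtree) : T1 ~=~ T2 -> T2 ~=~ T1.
Proof.
case=> f [[g fK gK] fr fe]; exists g; split; first by exists f.
  by rewrite -fr fK.
by move=> u v; rewrite -fe !gK.
Qed.

Lemma tiso_of_parent (T1 T2 : rtree) (f : tvertex T1 -> tvertex T2) :
  bijective f -> f (troot T1) = troot T2 ->
  (forall u, f (tparent u) = tparent (f u)) -> T1 ~=~ T2.
Proof.
move=> bij_f fr fp; exists f; split=> // u v.
by rewrite /tedge -fp -fr !(bij_eq bij_f).
Qed.

Lemma tparent_of_tiso (T1 T2 : rtree) (f : tvertex T1 -> tvertex T2) :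
  f (troot T1) = troot T2 -> (forall u v, tedge (f u) (f v) = tedge u v) ->
  forall u, f (tparent u) = tparent (f u).
Proof.
move=> fr fe u; have [->|uNr] := eqVneq u (troot T1).
  by rewrite tparent_root fr tparent_root.
have := fe u (tparent u); rewrite /tedge uNr eqxx /=.
by case/andP=> _ /eqP.
Qed.

(** * Trees with an equitable labelling *)

Section Labelled.
Variable L : eqType.

Definition children (T : rtree) (l : tvertex T -> L) (u : tvertex T) (b : L) :=
  [set v | tedge v u && (l v == b)].

(** [N] is the quotient matrix of an equitable partition of the vertices, read from parents to
    children. *)
Definition equitable (N : L -> L -> nat) (T : rtree) (l : tvertex T -> L) :=
  forall u b, #|children l u b| = N (l u) b.

Definition labelled (N : L -> L -> nat) (a : L) (T : rtree) :=
  exists2 l : tvertex T -> L, equitable N l & l (troot T) = a.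

Definition depth (T : rtree) (v : tvertex T) : nat :=
  ex_minn (let: ex_intro n e := tparent_reach v in ex_intro
    (fun n => iter n (@tparent T) v == troot T) n (introT eqP e)).

Lemma depth_root (T : rtree) : depth (troot T) = 0.
Proof.
by rewrite /depth; case: ex_minnP => m _ /(_ 0 (eqxx _)); case: m.
Qed.

Lemma depth_parent (T : rtree) (v : tvertex T) :
  v != troot T -> depth v = (depth (tparent v)).+1.
Proof.
move=> vNr; rewrite /depth; case: ex_minnP => -[|m].
  by rewrite /= (negPf vNr).
rewrite iterSr => vm min_m; case: ex_minnP => n vn min_n.
by apply/eqP; rewrite eqSS eqn_leq min_n // -ltnS min_m // iterSr.
Qed.

Section Transport.
Variables (N : L -> L -> nat).

(* The i-th child with label b of u goes to the i-th child with label b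
   of the image of u. *)
Definition match_child (T1 T2 : rtree) l1 l2 (u1 v : tvertex T1)
    (u2 : tvertex T2) : tvertex T2 :=
  nth (troot T2) (enum (children l2 u2 (l1 v)))
    (index v (enum (children l1 u1 (l1 v)))).

(** The recursion runs on the depth, which drops by one at the parent; at depth 0 the only vertex is
    the root. *)
Fixpoint transport_rec (T1 T2 : rtree) (l1 : tvertex T1 -> L)
    (l2 : tvertex T2 -> L) (n : nat) (v : tvertex T1) : tvertex T2 :=
  if n is m.+1 then
    match_child l1 l2 (tparent v) v (transport_rec l1 l2 m (tparent v))
  else troot T2.

Definition transport (T1 T2 : rtree) (l1 : tvertex T1 -> L)
    (l2 : tvertex T2 -> L) (v : tvertex T1) : tvertex T2 :=
  transport_rec l1 l2 (depth v) v.

Lemma transport_root (T1 T2 : rtree) l1 l2 :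
  @transport T1 T2 l1 l2 (troot T1) = troot T2.
Proof. by rewrite /transport depth_root. Qed.

Lemma transportE (T1 T2 : rtree) l1 l2 v : v != troot T1 ->
  @transport T1 T2 l1 l2 v =
  match_child l1 l2 (tparent v) v (transport l1 l2 (tparent v)).
Proof. by move=> vNr; rewrite /transport depth_parent. Qed.

(** Equal labels of [u1] and [u2] give child lists of equal length, so an index valid in one is
    valid in the other; the lists have no duplicates, so [index] undoes [nth]. *)
Lemma match_childP (T1 T2 : rtree) l1 l2 u1 v u2 :
  @equitable N T1 l1 -> @equitable N T2 l2 -> l1 u1 = l2 u2 -> tedge v u1 ->
  [/\ tedge (match_child l1 l2 u1 v u2) u2,
      l2 (match_child l1 l2 u1 v u2) = l1 v
    & match_child l2 l1 u2 (match_child l1 l2 u1 v u2) u1 = v].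
Proof.
move=> eq1 eq2 lu vu; set w := match_child _ _ _ _ _.
have vin : v \in enum (children l1 u1 (l1 v)).
  by rewrite mem_enum inE vu eqxx.
have szE : size (enum (children l2 u2 (l1 v))) =
           size (enum (children l1 u1 (l1 v))).
  by rewrite -!cardE eq1 eq2 lu.
have ilt : index v (enum (children l1 u1 (l1 v))) <
           size (enum (children l2 u2 (l1 v))).
  by rewrite szE index_mem.
have : w \in enum (children l2 u2 (l1 v)) by exact: mem_nth.
rewrite mem_enum inE => /andP[wu /eqP lw]; split=> //.
by rewrite /match_child lw /w index_uniq ?enum_uniq // nth_index.
Qed.

Lemma tree_ind_parent (T : rtree) (Q : tvertex T -> Prop) :
  Q (troot T) -> (forall v, v != troot T -> Q (tparent v) -> Q v) ->
  forall v, Q v.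
Proof.
move=> Qr Qp v; have [n] := tparent_reach v.
elim: n v => [|n IHn] v; first by move=> /= ->.
rewrite iterSr => /IHn Qpv; have [->//|vNr] := eqVneq v (troot T).
exact: Qp.
Qed.

(** The three claims go through one induction from the root: matching the children of two vertices
    needs their labels to agree, and inverting the match at [v] needs the inversion at its
    parent. *)
Lemma transportP (T1 T2 : rtree) l1 l2 v :
  @equitable N T1 l1 -> @equitable N T2 l2 -> l1 (troot T1) = l2 (troot T2) ->
  [/\ tparent (transport l1 l2 v) = transport l1 l2 (tparent v),
      l2 (transport l1 l2 v) = l1 v
    & transport l2 l1 (transport l1 l2 v) = v].
Proof.
move=> eq1 eq2 lr; elim/tree_ind_parent: v => [|v vNr [_ lp pK]].
  by rewrite tparent_root !transport_root tparent_root lr.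
have vp : tedge v (tparent v) by rewrite /tedge vNr eqxx.
have [wp lw wK] := match_childP eq1 eq2 (esym lp) vp.
rewrite transportE //; set w := match_child _ _ _ _ _ in wp lw wK *.
case/andP: wp => wNr /eqP wp; split=> //.
by rewrite transportE // wp pK.
Qed.

Lemma labelled_tiso a (T1 T2 : rtree) :
  labelled N a T1 -> labelled N a T2 -> T1 ~=~ T2.
Proof.
move=> [l1 eq1 r1] [l2 eq2 r2].
apply: (@tiso_of_parent _ _ (transport l1 l2)).
- exists (transport l2 l1) => v.
    by have [] := transportP v eq1 eq2 (etrans r1 (esym r2)).
  by have [] := transportP v eq2 eq1 (etrans r2 (esym r1)).
- exact: transport_root.
- move=> v.
  by have [] := transportP v eq1 eq2 (etrans r1 (esym r2)).
Qed.
End Transport.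

Definition flabelled (N : L -> L -> nat) (F : forest) (cnt : L -> nat) :=
  exists2 a : fidx F -> L, forall i, labelled N (a i) (F i)
    & forall b, #|[set i | a i == b]| = cnt b.

Lemma eq_flabelled N F cnt1 cnt2 :
  cnt1 =1 cnt2 -> flabelled N F cnt1 -> flabelled N F cnt2.
Proof. by move=> E [a aP aC]; exists a => // b; rewrite aC E. Qed.

Lemma flabelled_copies N m T a :
  labelled N a T -> flabelled N (copies m T) (fun b => m * (a == b)).
Proof.
move=> aT; exists (fun=> a) => // b; case: eqVneq => [ab|ab].
  by rewrite muln1 -[RHS](card_ord m) -cardsT; apply: eq_card => i; rewrite !inE.
by rewrite muln0; apply/eqP; rewrite cards_eq0; apply/eqP/setP=> i; rewrite !inE.
Qed.

Lemma flabelled_fadd N F G cF cG :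
  flabelled N F cF -> flabelled N G cG ->
  flabelled N (fadd F G) (fun b => cF b + cG b).
Proof.
move=> [a aP aC] [a' aP' aC'].
exists (fun x => match x with inl i => a i | inr j => a' j end).
  by case.
move=> b; rewrite -aC -aC' -!sum1dep_card /=.
by rewrite big_sumType.
Qed.

Lemma flabelled_fbig N (F : nat -> forest) cnt n :
  (forall i, i < n -> flabelled N (F i) (cnt i)) ->
  flabelled N (fbig F n) (fun b => \sum_(i < n) cnt i b).
Proof.
elim: n => [|n IHn] Fn /=.
  exists (fun x : void => match x with end) => [[]|b].
  by rewrite big_ord0 -sum1dep_card big1 // => -[].
have IH : flabelled N (fbig F n) (fun b => \sum_(i < n) cnt i b).
  by apply: IHn => i lt_in; apply: Fn; exact: ltnW.
apply: eq_flabelled (flabelled_fadd IH (Fn n (ltnSn n))) => b.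
by rewrite big_ord_recr.
Qed.

(** A component keeps its internal parent-child relation inside the new tree, and the children of
    the new root are the roots of the components; so only the row [N a] remains to be matched. *)
Lemma labelled_node N F a : flabelled N F (N a) -> labelled N a (node F).
Proof.
move=> [aF aP aC]; have /fin_all_exists2[l lP lr] := aP.
pose lab (x : node_vertex F) := if x is Some p then l (tag p) (tagged p) else a.
exists lab => // -[[i u]|] b /=.
  rewrite -lP.
  pose inc (v : tvertex (F i)) : node_vertex F := 
    Some (Tagged (fun i => tvertex (F i)) v).
  have inc_inj : injective inc by move=> v w [] /eqP; rewrite eq_Tagged => /eqP.
  rewrite -(card_imset _ inc_inj); apply: eq_card => x; rewrite !inE.
  apply/idP/imsetP => [|[v + ->]]; last first.
    by rewrite !inE /tedge /= => /andP[/andP[/negPf-> /eqP->]]; rewrite eqxx.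
  rewrite /tedge; case: x => [[j v]|] //=; case: (eqVneq v) => //= vNr.
  rewrite /inc {inc inc_inj}; case/andP=> /eqP[ji].
  case: _ / ji u => u /eqP.
  rewrite eq_Tagged => /= /eqP vE lv.
  by exists v => //; rewrite !inE /tedge vNr vE eqxx.
rewrite -aC.
pose inc (i : fidx F) : node_vertex F :=
  Some (Tagged (fun i => tvertex (F i)) (troot (F i))).
have inc_inj : injective inc by move=> i j [].
rewrite -(card_imset _ inc_inj); apply: eq_card => x; rewrite !inE.
apply/idP/imsetP => [|[i + ->]]; last first.
  by rewrite !inE /tedge /= eqxx lr.
rewrite /tedge; case: x => [[j v]|] //=; case: (eqVneq v) => //= -> lv.
by exists j => //; rewrite inE -lr.
Qed.

End Labelled.

(** * Iterated gcds and linear congruences *)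

Lemma dvdn_modr d m n : d %| m -> (d %| n %% m) = (d %| n).
Proof. by move=> dm; rewrite {2}(divn_eq n m) dvdn_addr // dvdn_mull. Qed.

Section IteratedGcd.
Variables (t n : nat).
Hypothesis n_gt0 : 0 < n.

(** With [g = gcdn (t ^ l) n], dividing by [g] leaves the gcd of [t * (t ^ l %/ g)] and [n %/ g],
    whose factor [t ^ l %/ g] is coprime to [n %/ g]. *)
Lemma gcdn_expS l :
  gcdn (t ^ l.+1) n = gcdn (t ^ l) n * gcdn t (n %/ gcdn (t ^ l) n).
Proof.
set g := gcdn (t ^ l) n.
have g_gt0 : 0 < g by rewrite gcdn_gt0 n_gt0 orbT.
have gn : g %| n by exact: dvdn_gcdr.
have gt : g %| t ^ l by exact: dvdn_gcdl.
rewrite -{1}(divnK gn) expnS -(divnK gt) mulnA -muln_gcdl mulnC.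
congr (_ * _); rewrite gcdnC Gauss_gcdl 1?gcdnC //.
by rewrite /coprime gcdnC -(eqn_pmul2r g_gt0) mul1n muln_gcdl !divnK.
Qed.

Lemma dvdn_gcd_exp l : gcdn (t ^ l) n %| gcdn (t ^ l.+1) n.
Proof. by rewrite gcdn_expS dvdn_mulr. Qed.

Lemma dvdn_gcd_expW l m : l <= m -> gcdn (t ^ l) n %| gcdn (t ^ m) n.
Proof.
move=> lm.
elim: m lm => [|m IHm]; first by rewrite leqn0 => /eqP->.
rewrite leq_eqVlt => /predU1P[-> //|/IHm lm].
exact: dvdn_trans lm (dvdn_gcd_exp m).
Qed.

(** The recurrence [gcdn_expS] telescopes: each iterated gcd is the ratio of consecutive values of
    [gcdn (t ^ l) n], so these values determine the whole sequence. *)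
Lemma prod_igcd_prefix d : \prod_(x <- igcd_prefix t n d) x = gcdn (t ^ d) n.
Proof.
elim: d => [|d IHd] /=; first by rewrite big_nil gcd1n.
by rewrite big_rcons /= IHd gcdn_expS mulnC.
Qed.

Lemma igcd_nextE d : igcd_next t n d = gcdn t (n %/ gcdn (t ^ d) n).
Proof. by rewrite /igcd_next prod_igcd_prefix. Qed.

Lemma size_igcd_prefix d : size (igcd_prefix t n d) = d.
Proof. by elim: d => //= d IHd; rewrite size_rcons IHd. Qed.

Lemma nth_igcd_prefix d l : l < d -> nth 0 (igcd_prefix t n d) l = igcd_next t n l.
Proof.
elim: d => //= d IHd; rewrite nth_rcons size_igcd_prefix ltnS leq_eqVlt.
by case/predU1P=> [->|ld]; rewrite ?ltnn ?eqxx // ld IHd.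
Qed.

Lemma size_igcd_gt0 : 0 < size (igcd t n).
Proof.
rewrite /igcd; case: ifP => // /negP gN1; rewrite size_igcd_prefix lt0n.
apply/negP=> /eqP len0; have [] := igcd_lengthP t n_gt0; rewrite len0.
by rewrite /igcd_next big_nil divn1 => /eqP.
Qed.

Lemma nth_igcd l : l < size (igcd t n) -> nth 0 (igcd t n) l = igcd_next t n l.
Proof.
rewrite /igcd; case: ifP => [/eqP g1|_]; last first.
  by rewrite size_igcd_prefix => /nth_igcd_prefix.
by case: l => //; rewrite /igcd_next big_nil divn1 g1.
Qed.

Lemma igcd_next_size : igcd_next t n (size (igcd t n)) = 1.
Proof.
rewrite /igcd; case: ifP => [/eqP g1|_]; last first.
  by rewrite size_igcd_prefix; case: (igcd_lengthP t n_gt0).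
by rewrite igcd_nextE expn1 g1 divn1.
Qed.

Hypothesis t_gt0 : 0 < t.

(** Put [y = g * z] and [d = gcdn t (n %/ g)]. Solvability forces [g * d], which is
    [gcdn (t * g) n], to divide [x]; after division the congruence has one solution modulo [m'],
    hence [d] solutions modulo [n %/ g]. *)
Lemma card_lin_congr g x : g %| n ->
  #|[set y : 'I_n | (g %| y) && (t * y == x %[mod n])]| =
  if gcdn (t * g) n %| x then gcdn t (n %/ g) else 0.
Proof.
move=> gn; have g_gt0 : 0 < g by exact: dvdn_gt0 gn.
case: ifPn => [dx|dNx]; last first.
  apply/eqP; rewrite cards_eq0; apply/eqP/setP=> y; rewrite !inE.
  apply: contraNF dNx => /andP[/dvdnP[z yE] /eqP tyx].
  rewrite -(dvdn_modr _ (dvdn_gcdr _ _)) -tyx dvdn_modr ?dvdn_gcdr // yE.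
  by rewrite mulnCA dvdn_mull // dvdn_gcdl.
set m := n %/ g; set d := gcdn t m.
have nE : n = g * m by rewrite mulnC divnK.
have m_gt0 : 0 < m by move: n_gt0; rewrite nE muln_gt0 => /andP[].
have d_gt0 : 0 < d by rewrite gcdn_gt0 t_gt0.
move: dx; rewrite {1}nE mulnC -muln_gcdr -/d => /dvdnP[w xE].
have dt : d %| t := dvdn_gcdl _ _; have dm : d %| m := dvdn_gcdr _ _.
set t' := t %/ d; set m' := m %/ d.
have tE : t = d * t' by rewrite mulnC divnK.
have mE : m = d * m' by rewrite mulnC divnK.
have t'_gt0 : 0 < t' by move: t_gt0; rewrite tE muln_gt0 => /andP[].
have m'_gt0 : 0 < m' by move: m_gt0; rewrite mE muln_gt0 => /andP[].
have co : gcdn t' m' = 1.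
  by apply/eqP; rewrite -(eqn_pmul2l d_gt0) muln_gcdr -tE -mE muln1.
(* Bezout makes [u] an inverse of [t'] modulo [m']. *)
case: (egcdnP m' t'_gt0) => u v uE _; rewrite co in uE.
have solve z : (t' * z == w %[mod m']) = (z == u * w %[mod m']).
  apply/eqP/eqP => [zE|zE].
    rewrite -modnMmr -zE modnMmr mulnA uE mulnDl mul1n mulnAC.
    by rewrite -modnDml modnMl add0n.
  rewrite -modnMmr zE modnMmr mulnA [t' * u]mulnC uE mulnDl mul1n mulnAC.
  by rewrite -modnDml modnMl add0n.
(* The solutions in Z_n are [g * (z0 + j * m')] for [j < d]. *)
pose z0 := (u * w) %% m'.
have lt_f (j : 'I_d) : g * (z0 + j * m') < n.
  rewrite nE ltn_pmul2l // mE; apply: (@leq_trans (j.+1 * m')).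
    by rewrite mulSn ltn_add2r ltn_pmod.
  by rewrite leq_mul2r ltn_ord orbT.
pose f j : 'I_n := Ordinal (lt_f j).
have f_inj : injective f.
  move=> i j [] /eqP; rewrite eqn_pmul2l // eqn_add2l eqn_pmul2r // => /eqP.
  exact: val_inj.
rewrite -[RHS]card_ord -(card_imset _ f_inj); apply: eq_card => y.
have congrE z : (t * (g * z) == x %[mod n]) = (z == z0 %[mod m']).
  rewrite /z0 modn_mod -solve xE nE mE tE.
  have -> : d * t' * (g * z) = (g * d) * (t' * z) by rewrite mulnACA [d * g]mulnC.
  by rewrite [w * _]mulnC [g * (d * m')]mulnA -!muln_modr eqn_pmul2l // muln_gt0 g_gt0.
rewrite !inE; apply/andP/imsetP => [[/dvdnP[z yE]]|[j _ ->]]; last first.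
  by rewrite dvdn_mulr //= congrE addnC modnMDl.
rewrite yE [z * g]mulnC congrE => /eqP zE.
have {}zE : z = z0 + z %/ m' * m'.
  by rewrite {1}(divn_eq z m') zE addnC /z0 modn_mod.
have lt_j : z %/ m' < d.
  by rewrite ltn_divLR // -mE -(ltn_pmul2l g_gt0) -nE mulnC -yE ltn_ord.
exists (Ordinal lt_j) => //; apply: val_inj; rewrite /= yE mulnC.
by rewrite {1}zE.
Qed.
End IteratedGcd.

(** * Trees presented by representatives of their vertices *)

(* [A] selects the representatives, [E] tells when two of them denote the same
   vertex, [r] represents the root and [s] the parent map. *)
Definition presents (P : Type) (A : P -> Prop) (E : P -> P -> Prop) (r : P)
    (s : P -> P) (T : rtree) : Prop :=
  exists pi : P -> tvertex T,
    [/\ A r /\ pi r = troot T,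
        forall v, exists2 p, A p & pi p = v,
        forall p q, A p -> A q -> (pi p = pi q <-> E p q)
      & forall p, A p -> A (s p) /\ tparent (pi p) = pi (s p)].

Lemma presents_tiso P A E r s T1 T2 :
  @presents P A E r s T1 -> T1 ~=~ T2 -> presents A E r s T2.
Proof.
case=> pi [[Ar pir] pi_surj piE pis] [f [[g fK gK] fr fe]].
exists (f \o pi); split=> /=.
- by rewrite pir.
- by move=> v; have [p Ap pv] := pi_surj (g v); exists p; rewrite // pv gK.
- move=> p q Ap Aq; rewrite -piE //; split=> [|->] //.
  exact: can_inj fK _ _.
- move=> p Ap; have [Asp <-] := pis p Ap; split=> //.
  by rewrite (tparent_of_tiso fr fe).
Qed.

(** The vertex map picks a representative [rho v] and applies [phi]; compatibility of [phi] with
    [E1] and [E2] makes the result independent of the choice, so every condition on [phi] is only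
    required up to [E2]. *)
Lemma tiso_presents (P1 P2 : Type) A1 E1 r1 s1 A2 E2 r2 s2 T1 T2
    (phi : P1 -> P2) :
  @presents P1 A1 E1 r1 s1 T1 -> @presents P2 A2 E2 r2 s2 T2 ->
  (forall p, A1 p -> A2 (phi p)) ->
  (forall p q, A1 p -> A1 q -> (E1 p q <-> E2 (phi p) (phi q))) ->
  (forall q, A2 q -> exists2 p, A1 p & E2 (phi p) q) ->
  E2 (phi r1) r2 ->
  (forall p, A1 p -> E2 (phi (s1 p)) (s2 (phi p))) ->
  T1 ~=~ T2.
Proof.
move=> [pi1 [[Ar1 pir1] surj1 piE1 pis1]] [pi2 [[Ar2 pir2] surj2 piE2 pis2]].
move=> phiA phiE phi_surj phir phis.
have /fin_all_exists2[rho rhoA rhoK] := surj1.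
pose f v := pi2 (phi (rho v)).
have fpi p : A1 p -> f (pi1 p) = pi2 (phi p).
  move=> Ap; apply/piE2; [exact: phiA | exact: phiA |].
  by apply/phiE => //; apply/piE1.
have f_inj : injective f.
  move=> u v /piE2 => /(_ (phiA _ (rhoA _)) (phiA _ (rhoA _))) /phiE.
  by move=> /(_ (rhoA _) (rhoA _)) /piE1 -/(_ (rhoA _) (rhoA _)); rewrite !rhoK.
have f_surj v : exists u, f u == v.
  have [q Aq <-] := surj2 v; have [p Ap pq] := phi_surj q Aq.
  by exists (pi1 p); rewrite fpi //; apply/eqP/piE2 => //; exact: phiA.
pose g v := xchoose (f_surj v).
have gK : cancel g f by move=> v; apply/eqP; exact: xchooseP (f_surj v).
apply: (@tiso_of_parent _ _ f).
- by exists g => // u; apply: f_inj; rewrite gK.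
- by rewrite -pir1 fpi // -pir2; apply/piE2 => //; exact: phiA.
move=> u; have Au := rhoA u; rewrite -{1}[u]rhoK.
have [As1 ->] := pis1 _ Au; rewrite fpi //.
have [As2 ->] := pis2 _ (phiA _ Au).
by apply/piE2 => //; [exact: phiA | exact: phis].
Qed.

(** Points of distinct summands denote the same vertex only when both denote the root; [i0] selects
    one summand in which to represent that common root. *)
Lemma presents_tsum (I : finType) (T : I -> rtree) (P : Type) A E r s (i0 : I) :
  (forall i, @presents P (A i) (E i) (r i) (s i) (T i)) ->
  presents (fun p : I * P => A p.1 p.2)
    (fun p q => (p.1 = q.1 /\ E p.1 p.2 q.2) \/
                (E p.1 p.2 (r p.1) /\ E q.1 q.2 (r q.1)))
    (i0, r i0) (fun p => (p.1, s p.1 p.2)) (tsum T).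
Proof.
move=> /fin_all_exists[pi piP].
pose inc i (v : tvertex (T i)) : tsum_vertex T :=
  omap (Tagged (tsum_nonroot T) (i := i)) (insub v).
have incr i : inc i (troot (T i)) = None by rewrite /inc insubF // eqxx.
have incN i v (vN : v != troot (T i)) :
    inc i v = Some (Tagged (tsum_nonroot T) (Sub v vN : tsum_nonroot T i)).
  by rewrite /inc insubT.
(* Vertices of the summands [i] and [j] have different types, so their equality is stated along a
   proof of [i = j]. *)
have inc_eq i j u v : inc i u = inc j v <->
    (exists e : i = j, eq_rect i (fun i => tvertex (T i)) u j e = v) \/
    (u = troot (T i) /\ v = troot (T j)).
  split=> [|[[e]|[-> ->]]]; last by rewrite !incr.
    have [->|uN] := eqVneq u (troot (T i)); have [->|vN] := eqVneq v (troot (T j)).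
    - by right.
    - by rewrite incr incN.
    - by rewrite incr incN.
    rewrite !incN => -[e e']; left; exists e.
    case: _ / e v vN e' => v vN /eqP; rewrite eq_Tagged => /= /eqP.
    by case.
  by case: _ / e v => v /= ->.
exists (fun p => inc p.1 (pi p.1 p.2)); split=> /=.
- by have [[Ar ->] _ _ _] := piP i0; rewrite incr.
- case=> [[i [v vN]]|].
    have [_ surj _ _] := piP i; have [p Ap pv] := surj v.
    by exists (i, p) => //=; rewrite pv incN.
  by have [[Ar rE] _ _ _] := piP i0; exists (i0, r i0); rewrite //= rE incr.
- move=> [i p] [j q] /= Ap Aq; rewrite inc_eq.
  have [[Ai ri] _ Ei _] := piP i; have [[Aj rj] _ Ej _] := piP j.
  rewrite -ri -rj Ei // Ej //; split=> -[|?]; try by right.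
    case=> e e'; left; split=> //; move: e'.
    by case: _ / e q Aq {Aj rj Ej} => q Aq /= /Ei; apply.
  case=> e; case: _ / e q Aq {Aj rj Ej} => q Aq Epq; left.
  by exists erefl; apply/Ei.
move=> [i p] /= Ap; have [_ _ _ si] := piP i; have [As <-] := si p Ap.
split=> //; have [->|vN] := eqVneq (pi i p) (troot (T i)).
  by rewrite tparent_root !incr.
by rewrite incN.
Qed.

(** [h] names the leaf denoted by a point, [None] standing for the root; all parents are the root,
    whence the constant parent map. *)
Lemma presents_star (P : Type) (m : nat) (h : P -> option 'I_m) r :
  h r = None -> (forall j, exists p, h p = Some j) ->
  presents (fun=> True) (fun p q => h p = h q) r (fun=> r)
    (node (copies m bullet)).
Proof.
move=> hr h_surj.
pose inc (j : 'I_m) : {i : fidx (copies m bullet) & tvertex (copies m bullet i)} :=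
  existT _ j tt.
exists (fun p => omap inc (h p)); split=> /=.
- by rewrite hr.
- case=> [[j []]|]; last by exists r; rewrite ?hr.
  by have [p hp] := h_surj j; exists p; rewrite ?hp.
- move=> p q _ _; split=> [|-> //].
  by case: (h p) (h q) => [i|] [j|] //= [->].
by move=> p _; rewrite hr; case: (h p).
Qed.

(** * Multiplication by t on Z_n *)

Definition tnil (t n x : nat) : Prop := exists N, n %| t ^ N * x.

(* [None], the label of the root, stands for an infinite height. *)
Definition above (a : option nat) (l : nat) : bool :=
  if a is Some k then l < k else true.

(** Children of label exactly [l] are those of label at least [l] minus those of label at least
    [l.+1]. Indices start at 0, so [nu l] is nu_(l+1). The root is nobody's child, hence 0 for
    [None]. *)
Definition zcount (nu : nat -> nat) (a b : option nat) : nat :=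
  if b is Some l then
    (if above a l then nu l else 0) - (if above a l.+1 then nu l.+1 else 0)
  else 0.

Section CyclicTree.
Variables (t n : nat).
Hypotheses (n_gt0 : 0 < n) (t_gt0 : 0 < t).

Lemma tnil_congr x y : x = y %[mod n] -> tnil t n x -> tnil t n y.
Proof.
move=> xy [N]; rewrite /dvdn -modnMmr xy modnMmr => yN.
by exists N.
Qed.

Lemma tnil_mul x : tnil t n (t * x) <-> tnil t n x.
Proof.
split=> -[N xN]; first by exists N.+1; rewrite expnSr -mulnA.
by exists N; rewrite mulnCA dvdn_mull.
Qed.

(* The largest l such that x is a multiple of t ^ l modulo n. *)
Definition zlabel (x : nat) : option nat :=
  if n %| x then None
  else Some (find (fun l => ~~ (gcdn (t ^ l.+1) n %| x)) (iota 0 (igcd_length t n))).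

(** The divisors [gcdn (t ^ l) n] form a chain, so the first failure of divisibility is a threshold;
    nilpotency guarantees a failure within the search range when [n] does not divide [x]. *)
Lemma above_zlabel x l : tnil t n x -> above (zlabel x) l = (gcdn (t ^ l.+1) n %| x).
Proof.
move=> [N xN]; rewrite /zlabel; case: ifPn => /= [nx|nNx].
  by rewrite (dvdn_trans (dvdn_gcdr _ _) nx).
set D := igcd_length t n; set p := fun l => ~~ _.
have [D1 _] := igcd_lengthP t n_gt0; rewrite -/D igcd_nextE // in D1.
(* The cofactor of [gcdn (t ^ D) n] in [n] is coprime to [t], so it divides every nilpotent [x];
   divisibility by both factors would give [n %| x]. *)
have DN : ~~ (gcdn (t ^ D) n %| x).
  apply: contra nNx => Dx; set g := gcdn (t ^ D) n in D1 Dx *.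
  have gn : g %| n by exact: dvdn_gcdr.
  rewrite -(divnK gn) Gauss_dvd; last first.
    apply: (@coprime_dvdr _ (t ^ D)); first exact: dvdn_gcdl.
    by rewrite coprimeXr // coprime_sym /coprime D1.
  rewrite Dx andbT -(@Gauss_dvdr _ (t ^ N)); last first.
    by rewrite coprimeXr // coprime_sym /coprime D1.
  exact: dvdn_trans (dvdn_div gn) xN.
have has_p : has p (iota 0 D).
  apply/hasP; case: D DN {D1} => [|D] DN; first by rewrite gcd1n dvd1n in DN.
  by exists D; rewrite ?mem_iota ?add0n ?leq0n //=.
have lt_D : find p (iota 0 D) < D by rewrite -{2}(size_iota 0 D) -has_find.
have [lt_l|le_l] := ltnP l (find p (iota 0 D)).
  have := before_find 0 lt_l; rewrite nth_iota ?(ltn_trans lt_l) // add0n.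
  by move/negbFE.
apply/esym/negbTE; have := nth_find 0 has_p; rewrite nth_iota // add0n.
by apply: contra; apply: dvdn_trans; apply: dvdn_gcd_expW.
Qed.

Lemma labelled_presents T :
  presents (tnil t n) (fun x y => x = y %[mod n]) 0 (muln t) T ->
  labelled (zcount (igcd_next t n)) None T.
Proof.
move=> [pi [[A0 pi0] pi_surj piE pis]].
have /fin_all_exists2[rho rhoA rhoK] := pi_surj.
have rho_pi x : tnil t n x -> rho (pi x) = x %[mod n].
  by move=> Ax; apply/piE => //; rewrite rhoK.
have rho_root : n %| rho (troot T).
  by rewrite /dvdn -pi0 rho_pi // mod0n.
have rho_dvd v : n %| rho v -> v = troot T.
  move=> nv; rewrite -[v]rhoK -pi0; apply/piE => //.
  by rewrite mod0n; apply/eqP.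
(* [tparent] fixes the root, so [C l u] contains the root when [u] is the root, as 0 solves
   [t * y = 0]. This extra element cancels in the difference of consecutive sets. *)
pose C l u := [set v | (tparent v == u) && (gcdn (t ^ l) n %| rho v)].
have cardC l u : #|C l u| = if above (zlabel (rho u)) l then igcd_next t n l else 0.
  have gn := dvdn_gcdr (t ^ l) n.
  have := card_lin_congr n_gt0 t_gt0 (rho u) gn.
  rewrite above_zlabel // igcd_nextE //.
  have -> : gcdn (t * gcdn (t ^ l) n) n = gcdn (t ^ l.+1) n.
    rewrite muln_gcdr -gcdnA -expnS; congr gcdn.
    by apply/gcdn_idPr; rewrite dvdn_mull.
  move=> <-; pose h v : 'I_n := Ordinal (ltn_pmod (rho v) n_gt0).
  have h_inj : injective h.
    by move=> u' v [] /piE; rewrite !rhoK; apply.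
  rewrite -(card_imset _ h_inj); apply: eq_card => y; rewrite !inE.
  apply/imsetP/idP => [[v + ->]|/andP[gy /eqP ty]].
    rewrite inE /= => /andP[/eqP pv gv].
    rewrite dvdn_modr // gv modnMmr /=; apply/eqP.
    have [Atv] := pis _ (rhoA v); rewrite rhoK pv => ->.
    by rewrite rho_pi.
  have Ay : tnil t n y by apply/tnil_mul; apply: tnil_congr (esym ty) _.
  exists (pi y); last by apply: val_inj; rewrite /= rho_pi // modn_small.
  have [Aty pty] := pis _ Ay; rewrite inE pty.
  rewrite -[X in _ == X]rhoK (introT eqP (proj2 (piE _ _ Aty (rhoA u)) ty)).
  by rewrite -(dvdn_modr _ gn) rho_pi // dvdn_modr.
exists (zlabel \o rho); last by rewrite /= /zlabel rho_root.
move=> u [l|] /=; last first.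
  apply/eqP; rewrite cards_eq0; apply/eqP/setP=> v; rewrite !inE.
  rewrite /= /zlabel; case: ifP; last by rewrite andbF.
  by move/rho_dvd->; rewrite /tedge eqxx.
rewrite -!cardC -cardsDS; last first.
  apply/subsetP=> v; rewrite !inE => /andP[-> /=].
  by apply: dvdn_trans; exact: dvdn_gcd_exp.
apply: eq_card => v; rewrite !inE -above_zlabel //= /tedge.
case: eqVneq => [->|vN] /=.
  by rewrite /zlabel rho_root /= andbT; case: eqP.
case: (tparent v == u) => //=; rewrite ?andbF //.
case: l => [|l].
  rewrite gcd1n dvd1n andbT /zlabel; case: ifP => [/rho_dvd vr|_] /=.
    by rewrite vr eqxx in vN.
  by rewrite (inj_eq Some_inj) -leqNgt leqn0.
rewrite -above_zlabel // /zlabel; case: ifP => [/rho_dvd vr|_] /=.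
  by rewrite vr eqxx in vN.
by rewrite (inj_eq Some_inj) -leqNgt eqn_leq.
Qed.
End CyclicTree.

(** * Labelling of the elementary trees *)

Section ElementaryTree.
Variables (nu : nat -> nat) (v : seq nat).
Hypothesis nth_v : forall l, l < size v -> nth 0 v l = nu l.

(** This is the common shape of the forests below the roots of T^k_v and of T_v. The copies of T^i
    have root label [i], so each label comes from a single block. *)
Lemma labelled_elem_forest m k T :
  k < size v -> labelled (zcount nu) (Some k) T ->
  (forall i, i < k -> labelled (zcount nu) (Some i) (elem_sub v i)) ->
  flabelled (zcount nu)
    (fadd (copies m T)
       (fbig (fun i => copies (nth 0 v i - nth 0 v i.+1) (elem_sub v i)) k))
    (fun b => if b is Some l then
       if l < k then nu l - nu l.+1 else m * (k == l) else 0).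
Proof.
move=> kv Tk sub_k; apply: eq_flabelled; last first.
  apply: flabelled_fadd; first exact: flabelled_copies Tk.
  by apply: flabelled_fbig => i ik; apply: flabelled_copies; exact: sub_k.
move=> [l|] /=; last by rewrite muln0 big1 // => i _; rewrite muln0.
case: ltnP => [lk|kl].
  rewrite (inj_eq Some_inj) gtn_eqF // muln0 add0n (bigD1 (Ordinal lk)) //= eqxx muln1.
  rewrite big1 => [|i]; last first.
    by rewrite -val_eqE /= => /negPf ne; rewrite (inj_eq Some_inj) ne muln0.
  by rewrite addn0 !nth_v // ?(leq_ltn_trans lk) // (ltn_trans lk).
rewrite big1 ?addn0 // => i _.
by rewrite (inj_eq Some_inj) ltn_eqF ?muln0 // (leq_trans (ltn_ord i)).
Qed.

Lemma labelled_elem_sub k : k < size v ->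
  labelled (zcount nu) (Some k) (elem_sub v k).
Proof.
elim/ltn_ind: k => -[_ _|k IHk kv] /=.
  exists (fun=> Some 0) => // u b; case: b => [l|] /=.
  rewrite subn0; apply/eqP; rewrite cards_eq0; apply/eqP/setP=> w; rewrite !inE.
    by case: w; rewrite /tedge eqxx.
  apply/eqP; rewrite cards_eq0; apply/eqP/setP=> w; rewrite !inE.
  by case: w; rewrite /tedge eqxx.
apply: labelled_node; apply: eq_flabelled; last first.
  apply: labelled_elem_forest; first exact: ltnW.
    by apply: IHk => //; exact: ltnW.
  by move=> i ik; apply: IHk; [exact: ltnW | exact: ltn_trans (ltn_trans ik _) kv].
move=> [l|] //=; rewrite !ltnS; case: (ltngtP l k) => [//|kl|->].
- by rewrite ?subn0 ?muln0.
- by rewrite muln1 subn0 nth_v // ltnW.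
Qed.

(** The root has [nu l - nu l.+1] children of each label [l]: at the last index of [v] the value 1
    of the next term gives nu_d - 1, and beyond it the truncated difference vanishes. *)
Lemma labelled_elem_tree : 0 < size v -> nu (size v) = 1 ->
  (forall l, size v <= l -> nu l <= nu l.+1) ->
  labelled (zcount nu) None (elem_tree v).
Proof.
case E: (size v) => [//|d] _ nu1 nu_le; have dv : d < size v by rewrite E.
apply: labelled_node; apply: eq_flabelled; last first.
  rewrite E /=; apply: labelled_elem_forest => //.
    exact: labelled_elem_sub.
  by move=> i id; apply: labelled_elem_sub; exact: ltn_trans id dv.
move=> [l|] //=; case: (ltngtP l d) => [//|dl|->].
  by rewrite muln0; apply/esym/eqP; rewrite subn_eq0 nu_le.
by rewrite muln1 nu1 nth_v.
Qed.
End ElementaryTree.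

(** The labelling of Z_n depends on [n] only through its gcds with the powers of [t], so [m] may be
    [n] itself or its part [nu_part t n]. *)
Lemma elem_tree_presents t n m T : 0 < n -> 0 < t -> 0 < m ->
  (forall l, gcdn (t ^ l) m = gcdn (t ^ l) n) ->
  presents (tnil t n) (fun x y => x = y %[mod n]) 0 (muln t) T ->
  T ~=~ elem_tree (igcd t m).
Proof.
move=> n_gt0 t_gt0 m_gt0 gE PT; apply: labelled_tiso (labelled_presents _ _ PT) _ => //.
have nextE l : igcd_next t m l = igcd_next t n l.
  have g_gt0 : 0 < gcdn (t ^ l) n by rewrite gcdn_gt0 n_gt0 orbT.
  apply/eqP; rewrite -(eqn_pmul2l g_gt0) -{1}gE !igcd_nextE //.
  by rewrite -!gcdn_expS // gE.
apply: labelled_elem_tree.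
- by move=> l lt_l; rewrite nth_igcd.
- exact: size_igcd_gt0.
- by rewrite -nextE igcd_next_size.
move=> l le_l; rewrite -!nextE.
have := igcd_next_size t m_gt0; rewrite !igcd_nextE //; set D := size _ in le_l *.
have gm i : gcdn (t ^ i) m %| m by exact: dvdn_gcdr.
(* For [l >= D] the quotient [m %/ gcdn (t ^ l) m] divides [m %/ gcdn (t ^ D) m], which is coprime
   to [t], so the sequence stays at 1. *)
move=> D1; suff -> : gcdn t (m %/ gcdn (t ^ l) m) = 1.
  by rewrite gcdn_gt0 t_gt0.
apply/eqP; rewrite -dvdn1 -D1 dvdn_gcd dvdn_gcdl /=.
apply: dvdn_trans (dvdn_gcdr _ _) _.
have /dvdnP[q qE] := dvdn_gcd_expW t m_gt0 le_l.
rewrite -(@dvdn_pmul2r (gcdn (t ^ l) m)) ?gcdn_gt0 ?m_gt0 ?orbT //.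
by rewrite divnK // qE mulnCA divnK // dvdn_mull.
Qed.

(** * Fans *)

(** Take the least [N] reaching [v]. A periodic iterate before it would recur after [N] periods,
    when the orbit is already stuck at the fixed point [v], contradicting minimality. *)
Lemma attached_fixP (V : finType) (f : V -> V) (v u : V) : f v = v ->
  reflect (exists N, iter N f u = v) (attached f v u).
Proof.
move=> fv; apply: (iffP (attachedP _ _ _)) => [[N uN _]|[N0 uN0]].
  by exists N.
have exN : exists N, iter N f u == v by exists N0; apply/eqP.
case: (ex_minnP exN) => N /eqP uN min_N; exists N => // m mN.
apply/negP=> /periodicP[k k_gt0 uk].
suff /eqP/min_N : iter m f u = v by rewrite leqNgt mN.
have ukj j : iter (j * k) f (iter m f u) = iter m f u.
  by elim: j => [//|j IHj]; rewrite mulSn iterD IHj uk.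
rewrite -(ukj N) -iterD -(subnK (leq_trans (leq_pmulr N k_gt0) (leq_addr m _))).
by rewrite iterD uN iter_fix.
Qed.

(** [B] selects the representatives of points of [V], and [A] those whose point lies in the tree. *)
Lemma presents_attached (V : finType) (f : V -> V) (v : V) (P : Type)
    (B A : P -> Prop) E r s (pt : P -> V) :
  f v = v ->
  (forall u, exists2 p, B p & pt p = u) ->
  (forall p q, B p -> B q -> (pt p = pt q <-> E p q)) ->
  (forall p, B p -> B (s p) /\ f (pt p) = pt (s p)) ->
  B r -> pt r = v ->
  (forall p, B p -> (attached f v (pt p) <-> A p)) ->
  presents (fun p => B p /\ A p) E r s (attached_tree f v).
Proof.
move=> fv pt_surj ptE pts Br ptr ptA.
pose pi p : tvertex (attached_tree f v) := insubd (att_root f v) (pt p).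
have piE p : B p -> A p -> val (pi p) = pt p.
  by move=> Bp Ap; rewrite insubdK //; apply/ptA.
have As p : B p -> A p -> A (s p).
  move=> Bp /(ptA p Bp)/(attached_fixP _ fv)[N pN]; have [Bsp sE] := pts p Bp.
  by apply/ptA => //; apply/(attached_fixP _ fv); exists N; rewrite -sE -iterSr /= pN.
have Ar : A r by apply/ptA; rewrite // ptr attached_refl.
exists pi; split.
- by split=> //; apply: val_inj; rewrite piE.
- case=> u uA; have [p Bp pu] := pt_surj u.
  have Ap : A p by apply/ptA; rewrite // pu.
  by exists p => //; apply: val_inj; rewrite piE.
- move=> p q [Bp Ap] [Bq Aq]; rewrite -ptE // -(piE p) // -(piE q) //.
  by split=> [-> | /val_inj].
move=> p [Bp Ap]; have [Bsp sE] := pts p Bp; have Asp := As p Bp Ap.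
split=> //; apply: val_inj; rewrite piE //= -sE.
have [pr|pN] := eqVneq (pi p) (att_root f v); last by rewrite att_parentE // piE.
by rewrite pr att_parent_root -(piE p) // pr /= fv.
Qed.

(* The representative (i, x) stands for the class of x in the copy of
   Z_(c_(i+1)): the copy of Z_(c_0) is contained in each of the others. *)
Definition fan_key (c0 : nat) (cs : seq nat) (p : nat * nat) : nat * nat :=
  let d := nth 0 cs p.1 %/ c0 in
  if d %| p.2 then (0, (p.2 %/ d) %% c0) else (p.1.+1, p.2 %% nth 0 cs p.1).

(** * Presentation of the tree of a fan by pairs (i, x) of natural numbers *)

Section FanPresentation.
Variables (t c0 : nat) (cs : seq nat).
Hypotheses (c0_gt0 : 0 < c0) (cs_ok : all (fun c => (0 < c) && (c0 %| c)) cs).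
Hypothesis cs_gt0 : 0 < size cs.

Local Notation c i := (nth 0 cs i).
Local Notation d i := (nth 0 cs i %/ c0).
Local Notation key := (fan_key c0 cs).

Lemma fan_mod_gt0 i : i < size cs -> 0 < c i.
Proof. by move=> i_lt; have /andP[] := allP cs_ok _ (mem_nth 0 i_lt). Qed.

Lemma fan_modE i : i < size cs -> c i = c0 * d i.
Proof.
move=> i_lt; have /andP[_ ci] := allP cs_ok _ (mem_nth 0 i_lt).
by rewrite mulnC divnK.
Qed.

Lemma fan_div_gt0 i : i < size cs -> 0 < d i.
Proof.
by move=> i_lt; move: (fan_mod_gt0 i_lt); rewrite {1}fan_modE // muln_gt0 => /andP[].
Qed.

Lemma fan_div_dvd i : i < size cs -> d i %| c i.
Proof. by move=> i_lt; rewrite [X in _ %| X]fan_modE // dvdn_mull. Qed.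

Lemma fan_key_mod i x : i < size cs -> key (i, x %% c i) = key (i, x).
Proof.
move=> i_lt; rewrite /fan_key /= dvdn_modr ?fan_div_dvd // modn_mod.
case: ifP => // _; congr pair.
have cd : c i %/ d i = c0 by rewrite [X in X %/ _]fan_modE // mulnK ?fan_div_gt0.
by rewrite divn_modl ?fan_div_dvd // cd modn_mod.
Qed.

Lemma fan_key_same i x y : i < size cs ->
  key (i, x) = key (i, y) <-> x = y %[mod c i].
Proof.
move=> i_lt; split=> [|xy]; last by rewrite -fan_key_mod // xy fan_key_mod.
rewrite /fan_key /=; case: ifP => dx; case: ifP => dy [] //.
move: (fan_modE i_lt) dx dy; set e := d i => -> dx dy E.
by rewrite -(divnK dx) -(divnK dy) -!muln_modl E.
Qed.

Lemma fan_key0 i : key (i, 0) = (0, 0).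
Proof. by rewrite /fan_key /= dvdn0 div0n mod0n. Qed.

Lemma fan_key_eq0 i x : i < size cs -> key (i, x) = (0, 0) <-> c i %| x.
Proof.
move=> i_lt; rewrite -(fan_key0 i) fan_key_same // mod0n.
by split=> /eqP.
Qed.

(** A complete invariant of the identification on the disjoint union; component i+1 of the fan is
    entry i of [cs], and component 0 is already normalised. *)
Definition fan_pt_key (a : fan_pt c0 cs) : nat * nat :=
  if tag a == ord0 then (0, tagged a : nat) else key ((tag a).-1, tagged a : nat).

Lemma fan_rel_key a b : fan_rel a b -> fan_pt_key a = fan_pt_key b.
Proof.
have identK p q : fan_ident p q -> fan_pt_key p = fan_pt_key q.
  move=> /existsP[i /existsP[x /and3P[iN0 /eqP-> /eqP->]]].
  rewrite /fan_pt_key /= (negPf iN0).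
  case: i iN0 => -[//|i] /= i_lt _; rewrite {}/fan_mod /= in x *.
  have x_lt : x < c0 by case: x => x /=; rewrite prednK.
  move: (nat_of_ord x) x_lt => {x} x x_lt.
  rewrite ltnS in i_lt; rewrite prednK ?fan_mod_gt0 //.
  rewrite fan_key_mod // /fan_key /= dvdn_mull // mulnK ?fan_div_gt0 //.
  by rewrite modn_small.
case/connectP=> s; elim: s a => [|a' s IHs] a /=; first by move=> _ ->.
case/andP=> step /IHs{}IHs /IHs <-.
by case/orP: step => /identK.
Qed.

(** A point with key [(0, x)] is related to [x] in component 0, through which two such points are
    joined; any other key determines its point. *)
Lemma fan_key_rel a b : fan_pt_key a = fan_pt_key b -> fan_rel a b.
Proof.
have toZ p x : fan_pt_key p = (0, x) ->
    exists x' : Zmod c0, fan_rel p (@fan_mk c0 cs ord0 x') /\ x = x'.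
  case: p => i y; rewrite /fan_pt_key /=; case: eqP => [i0|/eqP iN0].
    case=> <-; move: i0 y => -> y; by exists y.
  case: i iN0 y => -[//|i] /= i_lt _ y; rewrite /fan_key /=.
  case: ifP => // dy [] <-.
  exists (inZp (y %/ d i)); split; last by rewrite /= (prednK c0_gt0).
  apply: connect1; apply/orP; left; apply/existsP; exists (Ordinal i_lt).
  apply/existsP; exists (inZp (y %/ d i)).
  apply/and3P; split=> //; apply/eqP; congr fan_mk; apply: val_inj => /=.
  have i_lt' : i < size cs := i_lt.
  have y_lt : y < c i.
    by case: y {dy} => y /=; rewrite /fan_mod /= prednK ?fan_mod_gt0.
  rewrite /fan_mod /=; move: (nat_of_ord y) dy y_lt => {} y dy y_lt.
  rewrite (prednK c0_gt0) prednK ?fan_mod_gt0 //.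
  rewrite (modn_small (_ : y %/ _ < c0)) ?divnK ?modn_small //.
  by rewrite ltn_divLR ?fan_div_gt0 // -fan_modE.
case Ea: (fan_pt_key a) => [[|i] x] /esym Eb.
  have [xa [ra Exa]] := toZ a _ Ea; have [xb [rb E]] := toZ b _ Eb.
  apply: fan_rel_trans ra _; have -> : xa = xb.
    by apply: val_inj; rewrite /= -Exa.
  by rewrite fan_rel_sym.
move: Ea Eb; case: a => ia xa; case: b => ib xb; rewrite /fan_pt_key /=.
case: eqP => // /eqP iaN0; rewrite /fan_key /=; case: ifP => // _ [ia_i xaE].
case: eqP => // /eqP ibN0; case: ifP => // _ [ib_i xbE].
have ii : ia = ib.
  apply: val_inj => /=; case: ia ib {xa xb xaE xbE} ia_i ib_i iaN0 ibN0.
  by move=> [|ia] ? [[|ib] ?] //= <- [->].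
case: _ / ii xb ib_i ibN0 xbE => xb _ _ xbE.
suff -> : xa = xb by exact: fan_rel_refl.
have x_lt (z : Zmod (fan_mod c0 ia)) : z < c ia.-1.
  case: ia iaN0 {ia_i xa xb xaE xbE} z => -[//|ia] /= ia_lt _ z.
  by rewrite -[X in _ < X]prednK ?fan_mod_gt0.
by apply: val_inj; move: xaE xbE; rewrite /= !modn_small // => -> ->.
Qed.

Lemma fan_classP a b : fan_class a = fan_class b <-> fan_pt_key a = fan_pt_key b.
Proof.
split=> [/eqmodP/fan_rel_key // | E].
by apply/eqmodP; exact: fan_key_rel.
Qed.

(** The index is shifted past component 0; [inord] is exact as long as [p.1 < size cs]. *)
Definition fan_point (p : nat * nat) : fan c0 cs :=
  fan_class (fan_mk (inZp p.2 : Zmod (fan_mod c0 (inord p.1.+1 : 'I_(size cs).+1)))).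

Lemma fan_point_key p : p.1 < size cs ->
  fan_pt_key (fan_mk (inZp p.2 : Zmod (fan_mod c0 (inord p.1.+1 : 'I_(size cs).+1))))
  = key p.
Proof.
case: p => i x /= i_lt; rewrite /fan_pt_key /= -val_eqE /= /fan_mod inordK //=.
by rewrite prednK ?fan_mod_gt0 // fan_key_mod.
Qed.

Lemma fan_pointP p q : p.1 < size cs -> q.1 < size cs ->
  fan_point p = fan_point q <-> key p = key q.
Proof. by move=> p_lt q_lt; rewrite fan_classP !fan_point_key. Qed.

Lemma fan_point_surj u : exists2 p, p.1 < size cs & fan_point p = u.
Proof.
rewrite -[u]reprK -/(fan_class (repr u)); case: (repr u) => i x.
have [i0|iN0] := eqVneq i ord0.
  (* A point of component 0 is represented inside the first copy, which exists because [cs] is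
     nonempty. *)
  move: i0 x => -> x; exists (0, x * d 0) => //.
  rewrite fan_classP fan_point_key // /fan_pt_key /= /fan_key /=.
  rewrite dvdn_mull // mulnK ?fan_div_gt0 // modn_small //.
  by rewrite -[X in _ < X]prednK.
have i_lt : i.-1 < size cs by case: i iN0 {x} => -[|i].
exists (i.-1, x : nat) => //.
by rewrite fan_classP fan_point_key // /fan_pt_key /= (negPf iN0).
Qed.

Lemma fan_point_root i : i < size cs -> fan_point (i, 0) = fan_root c0 cs.
Proof. by move=> i_lt; rewrite fan_classP fan_point_key // fan_key0. Qed.

Lemma fan_point_map p : fan_map t (fan_point p) = fan_point (p.1, t * p.2).
Proof.
rewrite /fan_point fan_mapE //; congr (fan_class (fan_mk _)).
by apply: val_inj; rewrite /= modnMmr.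
Qed.

Lemma fan_root_map : fan_map t (fan_root c0 cs) = fan_root c0 cs.
Proof. by rewrite -(fan_point_root cs_gt0) fan_point_map muln0. Qed.

Lemma fan_point_attached p : p.1 < size cs ->
  attached (@fan_map c0 cs t) (fan_root c0 cs) (fan_point p) <->
  tnil t (c p.1) p.2.
Proof.
case: p => i x /= i_lt.
have iterE N : iter N (@fan_map c0 cs t) (fan_point (i, x)) = fan_point (i, t ^ N * x).
  elim: N => [|N IHN] /=; first by rewrite mul1n.
  by rewrite IHN fan_point_map expnS mulnA.
have rootE N : iter N (@fan_map c0 cs t) (fan_point (i, x)) = fan_root c0 cs <->
    c i %| t ^ N * x.
  by rewrite iterE -(fan_point_root i_lt) fan_pointP // fan_key0 fan_key_eq0.
split=> [/(attached_fixP _ fan_root_map)[N /rootE xN]|[N /rootE xN]].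
  by exists N.
by apply/(attached_fixP _ fan_root_map); exists N.
Qed.

Lemma presents_fan :
  presents (fun p => p.1 < size cs /\ tnil t (c p.1) p.2)
    (fun p q => key p = key q) (0, 0) (fun p => (p.1, t * p.2)) (fan_tree t c0 cs).
Proof.
apply: (@presents_attached _ _ _ _ _ _ _ _ _ fan_point).
- exact: fan_root_map.
- exact: fan_point_surj.
- exact: fan_pointP.
- by move=> p p_lt; split=> //; rewrite fan_point_map.
- exact: cs_gt0.
- exact: fan_point_root.
- exact: fan_point_attached.
Qed.
End FanPresentation.

(** * Comparison of fans under changes of the moduli *)

Section FanIso.
Variables (t c0 : nat).
Hypotheses (t_gt0 : 0 < t) (c0_gt0 : 0 < c0).

Definition fan_ok (cs : seq nat) := all (fun c => (0 < c) && (c0 %| c)) cs.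

Lemma fan_dvd cs i : fan_ok cs -> i < size cs -> c0 %| nth 0 cs i.
Proof. by move=> /allP ok i_lt; have /andP[] := ok _ (mem_nth 0 i_lt). Qed.

Lemma fan_tree_perm (cs cs' : seq nat) :
  perm_eq cs cs' -> fan_ok cs' -> 0 < size cs' ->
  fan_tree t c0 cs ~=~ fan_tree t c0 cs'.
Proof.
move=> cs_cs' ok' sz'.
have ok : fan_ok cs by rewrite /fan_ok (perm_all _ cs_cs').
have szE := perm_size cs_cs'; have sz : 0 < size cs by rewrite szE.
(* [Is] lists the positions in [cs'] of the entries of [cs]; the isomorphism renumbers the copies by
   it and keeps the residue. *)
have /(perm_iotaP 0)[Is Is_iota csE] := cs_cs'.
have Is_size : size Is = size cs' by rewrite (perm_size Is_iota) size_iota.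
have Is_uniq : uniq Is by rewrite (perm_uniq Is_iota) iota_uniq.
have sig_lt i : i < size cs -> nth 0 Is i < size cs'.
  rewrite szE -Is_size => /(mem_nth 0); rewrite (perm_mem Is_iota) mem_iota.
  by rewrite add0n Is_size => /andP[].
have nth_sig i : i < size cs -> nth 0 cs i = nth 0 cs' (nth 0 Is i).
  by move=> i_lt; rewrite {1}csE (nth_map 0) // Is_size -szE.
have sig_inj i j : i < size cs -> j < size cs ->
    nth 0 Is i = nth 0 Is j -> i = j.
  by rewrite szE -Is_size => ? ? /eqP; rewrite nth_uniq // => /eqP.
apply: (tiso_presents (phi := fun p => (nth 0 Is p.1, p.2))
  (presents_fan t c0_gt0 ok sz) (presents_fan t c0_gt0 ok' sz')).
- by move=> [i x] /= [i_lt]; rewrite nth_sig //; split=> //; exact: sig_lt.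
- move=> [i x] [j y] /= [i_lt _] [j_lt _].
  rewrite /fan_key /= (nth_sig i) // (nth_sig j) //.
  case: ifP => _; case: ifP => _; split=> //.
    by case=> -> ->.
  by case=> /sig_inj-> // ->.
- move=> [i x] /= [i_lt iA].
  have : i \in Is by rewrite (perm_mem Is_iota) mem_iota.
  case/(nthP 0)=> j; rewrite Is_size -szE => j_lt jE.
  by exists (j, x) => /=; rewrite ?jE // nth_sig // jE.
- by rewrite !fan_key0.
- by [].
Qed.

Lemma fan_key_rcons cs b p : p.1 < size cs ->
  fan_key c0 (rcons cs b) p = fan_key c0 cs p.
Proof. by move=> p_lt; rewrite /fan_key nth_rcons p_lt. Qed.

(** The point is x' c_i / c_0, hence also x' c_1 / c_0 in the first copy; nilpotency in either copy
    means that [c0] divides some t^N x'. This moves shared points out of a copy being removed. *)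
Lemma fan_shared cs i x : fan_ok cs -> i < size cs ->
  nth 0 cs i %/ c0 %| x -> tnil t (nth 0 cs i) x ->
  exists2 y, tnil t (nth 0 cs 0) y & fan_key c0 cs (0, y) = fan_key c0 cs (i, x).
Proof.
move=> ok i_lt dx [N xN]; have sz : 0 < size cs by exact: leq_ltn_trans i_lt.
exists (x %/ (nth 0 cs i %/ c0) * (nth 0 cs 0 %/ c0)).
  exists N; move: xN.
  rewrite {1}(fan_modE ok i_lt) -{1}(divnK dx) mulnA dvdn_pmul2r ?(fan_div_gt0 ok) //.
  by move=> xN; rewrite [X in X %| _](fan_modE ok sz) mulnA dvdn_mul.
by rewrite /fan_key /= dx dvdn_mull // mulnK // (fan_div_gt0 ok).
Qed.

(** If [b] divides t^N x, so does [b %/ c0], which is coprime to [t] and thus divides [x]: the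
    nilpotent points of the last copy all lie in the shared copy. *)
Lemma fan_tree_rcons_coprime cs b : fan_ok (rcons cs b) -> 0 < size cs ->
  coprime t (b %/ c0) -> fan_tree t c0 (rcons cs b) ~=~ fan_tree t c0 cs.
Proof.
move=> okb sz co; have := okb; rewrite /fan_ok all_rcons => /andP[b_ok ok].
have szb : 0 < size (rcons cs b) by rewrite size_rcons.
have nth_b : nth 0 (rcons cs b) (size cs) = b by rewrite nth_rcons ltnn eqxx.
have nth_cs i : i < size cs -> nth 0 (rcons cs b) i = nth 0 cs i.
  by move=> i_lt; rewrite nth_rcons i_lt.
apply: tiso_sym; apply: (tiso_presents (phi := id)
  (presents_fan t c0_gt0 ok sz) (presents_fan t c0_gt0 okb szb)).
- by move=> [i x] /= [i_lt iA]; rewrite size_rcons nth_cs //; split=> //; exact: ltnW.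
- by move=> [i x] [j y] /= [i_lt _] [j_lt _]; rewrite !fan_key_rcons.
- move=> [i x] /= []; rewrite size_rcons ltnS leq_eqVlt => /predU1P[-> xA|i_lt].
    have dx : nth 0 (rcons cs b) (size cs) %/ c0 %| x.
      case: xA => N; rewrite nth_b => xN.
      rewrite -(@Gauss_dvdr _ (t ^ N)); last by rewrite coprimeXr // coprime_sym.
      by apply: dvdn_trans xN; rewrite dvdn_div //; case/andP: b_ok.
    have [|y yA <-] := fan_shared okb _ dx xA; first by rewrite size_rcons.
    by exists (0, y) => //=; rewrite -nth_cs.
  by exists (i, x) => //=; rewrite -nth_cs.
- by rewrite !fan_key0.
- by [].
Qed.

Lemma count_dvdn_iota d m : 0 < d -> count (dvdn d) (iota 0 (m * d)) = m.
Proof.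
move=> d_gt0; rewrite -size_filter -[RHS](size_iota 0) -[RHS](size_map (muln^~ d)).
apply/perm_size/uniq_perm.
- by rewrite filter_uniq ?iota_uniq.
- by rewrite map_inj_uniq ?iota_uniq // => x y /eqP; rewrite eqn_pmul2r // => /eqP.
move=> x; rewrite mem_filter mem_iota /= add0n.
apply/andP/mapP => [[/dvdnP[y ->]]|[y]].
  by rewrite ltn_pmul2r // => y_lt; exists y; rewrite ?mem_iota.
by rewrite mem_iota add0n /= => y_lt ->; rewrite dvdn_mull // ltn_pmul2r.
Qed.

(** As [b] divides [t], multiplication sends the whole last copy to the root; its [b - c0] residues
    outside the shared copy become leaves at the root. *)
Lemma fan_tree_rcons_dvd cs b : fan_ok (rcons cs b) -> 0 < size cs -> b %| t ->
  fan_tree t c0 (rcons cs b) ~=~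
  tadd (fan_tree t c0 cs) (node (copies (b - c0) bullet)).
Proof.
move=> okb sz bt; have := okb; rewrite /fan_ok all_rcons => /andP[b_ok ok].
have szb : 0 < size (rcons cs b) by rewrite size_rcons.
have nth_b : nth 0 (rcons cs b) (size cs) = b by rewrite nth_rcons ltnn eqxx.
have nth_cs i : i < size cs -> nth 0 (rcons cs b) i = nth 0 cs i.
  by move=> i_lt; rewrite nth_rcons i_lt.
case/andP: b_ok => b_gt0 c0b; set d := b %/ c0.
have bE : b = c0 * d by rewrite mulnC divnK.
have d_gt0 : 0 < d by move: b_gt0; rewrite bE muln_gt0 => /andP[].
have db : d %| b by rewrite bE dvdn_mull.
pose L := [seq x <- iota 0 b | ~~ (d %| x)].
have L_size : size L = b - c0.
  have := count_predC (dvdn d) (iota 0 b); rewrite size_iota.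
  by rewrite {1}bE count_dvdn_iota // -size_filter => <-; rewrite addKn.
have L_mem x : (x %% b \in L) = ~~ (d %| x).
  by rewrite mem_filter mem_iota /= add0n ltn_pmod // andbT dvdn_modr.
(* A residue absent from [L] has index [size L = b - c0], so [insub] returns [None] exactly on the
   multiples of [d]. *)
pose h (p : nat * nat) : option 'I_(b - c0) := insub (index (p.2 %% b) L).
have hv p : omap val (h p) = if d %| p.2 then None else Some (index (p.2 %% b) L).
  have idx : (index (p.2 %% b) L < b - c0) = ~~ (d %| p.2).
    by rewrite -L_size index_mem L_mem.
  by rewrite /h; case: insubP => [j|]; rewrite idx; case: (d %| _) => // _ /= ->.
have hE p q : h p = h q <->
    (d %| p.2) = (d %| q.2) /\ (~~ (d %| p.2) -> p.2 = q.2 %[mod b]).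
  split=> [/(congr1 (omap val))|[E pq]]; last first.
    apply: (inj_omap val_inj); rewrite !hv -E.
    by case: ifP pq => // _ ->.
  rewrite !hv; case: ifPn => dp; case: ifPn => dq // [E]; split=> // _.
  by rewrite -[LHS](nth_index 0 (s := L)) ?L_mem // E nth_index // L_mem.
have h0 : h (0, 0) = None by have := hv (0, 0); rewrite /= dvdn0; case: (h _).
have hN p : h p = None <-> d %| p.2.
  by have := hv p; case: (h p) => [j|] /=; case: ifP.
have h_surj j : exists p, h p = Some j.
  have j_lt : j < size L by rewrite L_size.
  have jL := mem_nth 0 j_lt; exists (0, nth 0 L j); rewrite /h /=.
  have lt_b : nth 0 L j < b.
    by move: jL; rewrite mem_filter mem_iota => /andP[_ /andP[]].
  rewrite modn_small // index_uniq ?filter_uniq ?iota_uniq //.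
  exact: valK.
pose T (e : bool) := if e then node (copies (b - c0) bullet) else fan_tree t c0 cs.
have PT e : presents
    (if e then fun=> True else fun p => p.1 < size cs /\ tnil t (nth 0 cs p.1) p.2)
    (if e then fun p q => h p = h q else fun p q => fan_key c0 cs p = fan_key c0 cs q)
    (0, 0) (if e then fun=> (0, 0) else fun p => (p.1, t * p.2)) (T e).
  by case: e; [exact: presents_star | exact: presents_fan].
(* In the star every multiple of [d] denotes the root, while in the fan such multiples may be
   distinct shared points; they are therefore all sent to 0. *)
pose phi (p : bool * (nat * nat)) :=
  if p.1 then (size cs, if d %| p.2.2 then 0 else p.2.2) else p.2.
apply: tiso_sym; apply: (tiso_presents (phi := phi)
  (presents_tsum false PT) (presents_fan t c0_gt0 okb szb)).
- move=> [[] [i x]] /=; last first.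
    by case=> i_lt; rewrite size_rcons nth_cs //; split=> //; exact: ltnW.
  by move=> _; rewrite size_rcons nth_b; split=> //; exists 1; rewrite dvdn_mulr.
- have keyb x : fan_key c0 (rcons cs b) (size cs, if d %| x then 0 else x) =
      if d %| x then (0, 0) else ((size cs).+1, x %% b).
    rewrite /fan_key /= nth_b -/d; case: (boolP (d %| x)) => [_|/negPf->] //.
    by rewrite dvdn0 div0n mod0n.
  (* A point of the old fan meets a point of the star only at the root, since keys of the old fan
     never have first entry [(size cs).+1]. *)
  have mixed i j x y : i < size cs ->
      fan_key c0 cs (i, x) = fan_key c0 cs (0, 0) /\ h (j, y) = h (0, 0) <->
      fan_key c0 cs (i, x) = if d %| y then (0, 0) else ((size cs).+1, y %% b).
    move=> i_lt; rewrite h0 fan_key0 hN /=.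
    split=> [[-> ->] //|]; case: ifP => dy; first by [].
    by rewrite /fan_key /=; case: ifP => // _ [E]; rewrite E ltnn in i_lt.
  move=> [[] [i x]] [[] [j y]]; rewrite /phi /= ?keyb => pA qA.
  + rewrite h0 hE !hN /=; split=> [[[_ [-> xy]]|[-> ->]]|] //.
      by case: ifP xy => // _ ->.
    by case: ifPn => dx; case: ifPn => dy // E; [right | case: E; left].
  + rewrite fan_key_rcons; last by case: qA.
    split=> [[[] //|[hx ky]]|/esym/mixed].
      by apply/esym/(mixed j i); [case: qA | split].
    by move=> /(_ i (proj1 qA))[]; right.
  + rewrite fan_key_rcons; last by case: pA.
    split=> [[[] //|E]|/mixed]; first by apply/(mixed i j); [case: pA|].
    by move=> /(_ j (proj1 pA)); right.
  + case: pA qA => i_lt _ [j_lt _]; rewrite !fan_key_rcons //.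
    by split=> [[[]|[-> ->]]|] //; left.
- move=> [i x] /= []; rewrite size_rcons ltnS leq_eqVlt => /predU1P[-> xA|i_lt].
    have [dx|dNx] := boolP (d %| x); last first.
      by exists (true, (0, x)); rewrite // /phi /= (negPf dNx).
    have s_lt : size cs < size (rcons cs b) by rewrite size_rcons.
    have dx' : nth 0 (rcons cs b) (size cs) %/ c0 %| x by rewrite nth_b.
    have [y yA <-] := fan_shared okb s_lt dx' xA.
    by exists (false, (0, y)) => //=; rewrite -nth_cs.
  by rewrite nth_cs // => iA; exists (false, (i, x)).
- by rewrite !fan_key0.
- move=> [[] [i x]] //= _; rewrite /phi /= dvdn0 fan_key0; apply/esym.
  by apply/(fan_key_eq0 okb); rewrite ?size_rcons // nth_b dvdn_mulr.
Qed.

(** With a single copy the shared part is a subset of it and the fan is Z_n itself, whatever the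
    divisor [c0]. *)
Lemma presents_fan1 n : 0 < n -> c0 %| n ->
  presents (tnil t n) (fun x y => x = y %[mod n]) 0 (muln t) (fan_tree t c0 [:: n]).
Proof.
move=> n_gt0 c0n; have ok : fan_ok [:: n] by rewrite /fan_ok /= n_gt0 c0n.
have [pi [[[_ A0] pir] pi_surj piE pis]] := presents_fan t c0_gt0 ok isT.
exists (fun x => pi (0, x)); split=> //.
- move=> v; have [[i x] [/= i_lt xA] xv] := pi_surj v.
  by case: i i_lt xA xv => // _ xA xv; exists x.
- move=> x y xA yA; rewrite piE //; exact: (fan_key_same ok).
by move=> x xA; have [//|[_ sA] sE] := pis (0, x); split.
Qed.

(** The maximum is built by induction as either 0 or an admissible divisor; the divisor 1 is
    admissible, which excludes 0. *)
Lemma omega_partP c : 0 < c -> omega_part t c %| c /\ coprime (omega_part t c) t.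
Proof.
move=> c_gt0; set w := omega_part t c.
have w_gt0 : 0 < w.
  apply: (@leq_bigmax_seq _ _ _ id 1); last exact: coprime1n.
  by rewrite -dvdn_divisors // dvd1n.
suff : w = 0 \/ w %| c /\ coprime w t by case=> // w0; rewrite w0 in w_gt0.
rewrite /w /omega_part big_seq_cond.
elim/big_rec: _ => [|e m /andP[ed co]]; first by left.
have ec : e %| c by rewrite dvdn_divisors.
by case=> [->|[mc com]]; [rewrite maxn0; right | right; case: (leqP m e)].
Qed.

Lemma nu_part_gt0 c : 0 < c -> 0 < nu_part t c.
Proof.
move=> c_gt0; have [wc _] := omega_partP c_gt0.
by rewrite divn_gt0 ?(dvdn_gt0 c_gt0 wc) // (dvdn_leq c_gt0 wc).
Qed.

Lemma gcdn_nu_part l c : 0 < c -> gcdn (t ^ l) (nu_part t c) = gcdn (t ^ l) c.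
Proof.
move=> c_gt0; have [wc co] := omega_partP c_gt0.
rewrite -[in RHS](divnK wc) Gauss_gcdl // coprime_sym.
exact: coprimeXr.
Qed.

(** If x = x' c_i / c_0 is nilpotent then [c0] divides t^N x', hence x' by coprimality, so x is 0
    modulo c_i: distinct copies meet only at the root. *)
Lemma fan_tree_tsum k (c : k.-tuple nat) (T : 'I_k -> rtree) :
  fan_ok c -> 0 < k -> coprime c0 t ->
  (forall i : 'I_k, presents (tnil t (nth 0 c i)) (fun x y => x = y %[mod nth 0 c i])
     0 (muln t) (T i)) ->
  fan_tree t c0 c ~=~ tsum T.
Proof.
move=> ok k_gt0 co PT; have sz : 0 < size c by rewrite size_tuple.
have i_lt (i : 'I_k) : i < size c by rewrite size_tuple.
apply: tiso_sym.
have PS := presents_tsum (Ordinal k_gt0) PT.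
have PF := presents_fan t c0_gt0 ok sz.
apply: (tiso_presents (phi := fun p : 'I_k * nat => (p.1 : nat, p.2)) PS PF).
- by move=> [i x] /= xA; split.
- have shared (i : 'I_k) x : tnil t (nth 0 c i) x -> nth 0 c i %/ c0 %| x ->
      nth 0 c i %| x.
    move: (fan_modE ok (i_lt i)) (fan_div_gt0 ok (i_lt i)).
    set e := _ %/ c0 => -> e_gt0 [N xN] dx; move: xN.
    rewrite -(divnK dx) mulnA !dvdn_pmul2r // Gauss_dvdr //.
    exact: coprimeXr.
  move=> [i x] [j y] /= xA yA.
  have keyE l z := fan_key_eq0 ok z (i_lt l).
  rewrite !mod0n; split=> [[[<- xy]|[/eqP/keyE-> /eqP/keyE->]] //|].
    exact/(fan_key_same ok).
  have [dx|dNx] := boolP (nth 0 c i %/ c0 %| x).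
    have cx := shared i x xA dx; rewrite (proj2 (keyE i x) cx) => /esym/keyE cy.
    by right; split; apply/eqP.
  move=> E; left; move: (E); rewrite {1}/fan_key /= (negPf dNx).
  rewrite /fan_key /=; case: ifP => // _ [/val_inj ij _]; rewrite -{}ij in E *.
  by split=> //; apply/(fan_key_same ok).
- move=> [i x] /= [i_k xA]; rewrite size_tuple in i_k.
  by exists (Ordinal i_k, x).
- by rewrite !fan_key0.
- by [].
Qed.

Lemma fan_tree_coprime k (c : k.-tuple nat) : fan_ok c -> 0 < k -> coprime c0 t ->
  fan_tree t c0 c ~=~ tsum (fun i : 'I_k => elem_tree (igcd t (nu_part t (tnth c i)))).
Proof.
move=> ok k_gt0 co.
have tnthE (i : 'I_k) : tnth c i = nth 0 c i by exact: tnth_nth.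
have i_lt (i : 'I_k) : i < size c by rewrite size_tuple.
apply: (fan_tree_tsum ok k_gt0 co) => i.
have c_gt0 := fan_mod_gt0 ok (i_lt i).
(* The fan with the single modulus c_i supplies a tree presented by Z_(c_i), to be carried over to
   the elementary tree. *)
have P1 := presents_fan1 c_gt0 (fan_dvd ok (i_lt i)).
apply: (presents_tiso P1); apply: (elem_tree_presents c_gt0 t_gt0 _ _ P1).
  by rewrite tnthE nu_part_gt0.
by move=> l; rewrite tnthE gcdn_nu_part.
Qed.
End FanIso.

Theorem theorem3p12 (t k c0 : nat) (c : k.-tuple nat) :
  0 < t -> 2 <= k -> 0 < c0 ->
  (forall i : 'I_k, 0 < tnth c i) ->
  (forall i : 'I_k, c0 %| tnth c i) ->
  let ck := last 0 c in
  let c' := take k.-1 c in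
  [/\ (* (i) *)
      forall theta : {perm 'I_k},
        fan_tree t c0 c ~=~ fan_tree t c0 [tuple tnth c (theta i) | i < k],
      (* (ii) *)
      coprime c0 t ->
        fan_tree t c0 c
          ~=~ tsum (fun i : 'I_k => elem_tree (igcd t (nu_part t (tnth c i)))),
      (* (iii) *)
      coprime t (ck %/ c0) ->
        fan_tree t c0 c ~=~ fan_tree t c0 c',
      (* (iv) *)
      ck %| t ->
        fan_tree t c0 c
          ~=~ tadd (fan_tree t c0 c') (node (copies (ck - c0) bullet))
    & (* (v) *)
      forall b0 b1 : nat, 0 < b0 -> 0 < b1 -> b0 %| b1 ->
        fan_tree t b0 [:: b1] ~=~ elem_tree (igcd t b1)].
Proof.
move=> t_gt0 k_ge2 c0_gt0 c_gt0 c0_c ck c'.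
have ok : fan_ok c0 c by apply/all_tnthP => i; rewrite c_gt0 c0_c.
have k_gt0 : 0 < k by exact: ltnW.
have c'_size : size c' = k.-1 by rewrite size_takel // size_tuple leq_pred.
(* Here [2 <= k] enters: the shortened fan must keep at least one copy. *)
have c'_gt0 : 0 < size c' by rewrite c'_size -subn1 subn_gt0.
have cE : c = rcons c' ck :> seq nat.
  rewrite /c' /ck; case: (lastP c) (size_tuple c) => [|s x].
    by move: k_gt0 => /[swap] <-.
  rewrite size_rcons last_rcons => kE; have -> : k.-1 = size s by rewrite -kE.
  by rewrite -[in take _ _]cats1 take_size_cat.
split.
- move=> theta; apply: fan_tree_perm => //; last by rewrite size_tuple.
    by rewrite perm_sym; apply/tuple_permP; exists theta.
  by apply/all_tnthP => i; rewrite tnth_mktuple c_gt0 c0_c.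
- exact: fan_tree_coprime.
- by rewrite cE in ok *; exact: fan_tree_rcons_coprime.
- by rewrite cE in ok *; exact: fan_tree_rcons_dvd.
- move=> b0 b1 b0_gt0 b1_gt0 b01.
  exact: elem_tree_presents (presents_fan1 _ _ _ _).
Qed.
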